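(* The Bohr-Sommerfeld energy-momentum spectrum $\mathfrak{S}$ of the quantum spherical pendulum is the range of the map $$\mathbb{Z}_{\ge0}\times\mathbb{Z}\to\overline{\mathrm{R}}=\mathrm{image}\,\mathcal{EM}:\ (n,m)\mapsto\big(h_m(n),m\hbar\big).$$ In other words, $\mathfrak{S}=\{(h_m(n),m\hbar)\in\overline{\mathrm{R}} : n\in\mathbb{Z}_{\ge0},\ m\in\mathbb{Z}\}$.
   Context: Spherical pendulum: on $TS^2=\{(q,p)\in\mathbb{R}^3\times\mathbb{R}^3:\langle q,q\rangle=1,\langle q,p\rangle=0\}$ let $H=\tfrac12\langle p,p\rangle+q_3$, $L=q_1p_2-q_2p_1$, $\mathcal{EM}=(H,L)$. $\mathrm{R}$ is the set of regular values of $\mathcal{EM}$ lying in its image. The closure $\overline{\mathrm{R}}$ is the image of $\mathcal{EM}$, with boundary $\partial\overline{\mathrm{R}}=\{(\tfrac32s-\tfrac1{2s},\pm\tfrac{1-s^2}{\sqrt{-s}}):s\in[-1,0)\}$, and $\overline{\mathrm{R}}=\mathrm{R}\cup\partial\overline{\mathrm{R}}\cup\{(1,0)\}$. For $(h,\ell)\in\mathrm{R}$, with $P_{h,\ell}(x)=2(h-x)(1-x^2)-\ell^2$ and $x_-<x_+$ the consecutive roots of $P_{h,\ell}$ in $[-1,1]$ between which $P_{h,\ell}>0$, define $\mathcal{A}_1(h,\ell)=\frac1\pi\int_{x_-}^{x_+}\frac{\sqrt{P_{h,\ell}(x)}}{1-x^2}\,dx$. Extend $\mathcal{A}_1$ continuously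 to $\overline{\mathrm{R}}$; the extension is $0$ on $\partial\overline{\mathrm{R}}$ and $4/\pi$ at $(1,0)$. For each $\ell\in\mathbb{R}$ let $h_\ell$ be the minimum of $H$ on $L^{-1}(\ell)$. The function $h\mapsto\mathcal{A}_1(h,\ell)$ on $[h_\ell,\infty)$ is strictly increasing with range $[0,\infty)$. $\hbar>0$ is a parameter with $4/\pi\notin\hbar\mathbb{Z}$. For $n\in\mathbb{Z}_{\ge0}$, $m\in\mathbb{Z}$, $h_m(n)$ denotes the unique $h\in[h_{m\hbar},\infty)$ with $\mathcal{A}_1(h,m\hbar)=n\hbar$. The Bohr-Sommerfeld spectrum $\mathfrak{S}$ is the set of $(h,\ell)\in\overline{\mathrm{R}}$ satisfying the Bohr-Sommerfeld conditions $\oint A_1\,d\varphi_1=2\pi n\hbar$, $\oint A_2\,d\varphi_2=2\pi m\hbar$ for integers $n,m$. Explicitly: for $(h,\ell)\in\mathrm{R}$, $\mathcal{A}_1(h,\ell)=n\hbar$ and $\ell=m\hbar$ for some integers $n>0$ and $m$; for $(h,\ell)\in\partial\overline{\mathrm{R}}$, where $\mathcal{A}_1=0$ (so $n=0$), $\ell=m\hbar$ for some $m\in\mathbb{Z}$ (at $(-1,0)$ this holds with $n=m=0$). At $(1,0)$ the conditions would require $4/\pi\in\hbar\mathbb{Z}$, and $(1,0)$ does not belong to $\mathfrak{S}$. *)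

(* Defs.v *)
From HB Require Import structures.
From mathcomp Require Import all_boot all_order all_algebra.
From mathcomp Require Import all_classical all_reals all_analysis.

Set Implicit Arguments.
Unset Strict Implicit.
Unset Printing Implicit Defensive.

Import Order.TTheory GRing.Theory Num.Theory.
Import numFieldNormedType.Exports.

Local Open Scope classical_set_scope.
Local Open Scope ring_scope.

Definition dot (R : realType) (u v : 'rV[R]_3) : R :=
  \sum_(i < 3) u ord0 i * v ord0 i.

(* The coordinate u_(i+1): numerals below denote residues in 'I_3, so the
   mathematical indices 1, 2, 3 become 0, 1, 2. *)
Definition coord (R : realType) (u : 'rV[R]_3) (i : 'I_3) : R := u ord0 i.

(* TS^2 is the level set TS2_constraint = (1, 0) in R^3 x R^3. *)
Definition TS2_constraint (R : realType)
    (z : 'rV[R]_3 * 'rV[R]_3) : R * R :=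
  (dot z.1 z.1, dot z.1 z.2).

Definition TS2 (R : realType) : set ('rV[R]_3 * 'rV[R]_3) :=
  [set z | TS2_constraint z = (1, 0)].

(* Since (1, 0) is a regular value of TS2_constraint, this is the tangent
   space of TS^2 at z, as a subspace of the ambient R^3 x R^3. *)
Definition tangent_TS2 (R : realType) (z : 'rV[R]_3 * 'rV[R]_3) :
    set ('rV[R]_3 * 'rV[R]_3) :=
  [set w | 'd (@TS2_constraint R) z w = 0].

(* H, L and EM are defined by their formulas on all of R^3 x R^3; they are only
   used on TS2. *)
Definition Hfun (R : realType) (z : 'rV[R]_3 * 'rV[R]_3) : R :=
  2^-1 * dot z.2 z.2 + coord z.1 2.

Definition Lfun (R : realType) (z : 'rV[R]_3 * 'rV[R]_3) : R :=
  coord z.1 0 * coord z.2 1 - coord z.1 1 * coord z.2 0.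

Definition EM (R : realType) (z : 'rV[R]_3 * 'rV[R]_3) : R * R :=
  (Hfun z, Lfun z).

Definition EM_image (R : realType) : set (R * R) := @EM R @` @TS2 R.

Definition EM_regular_point (R : realType) (z : 'rV[R]_3 * 'rV[R]_3) : Prop :=
  'd (@EM R) z @` tangent_TS2 z = setT.

Definition regular_values (R : realType) : set (R * R) :=
  [set c | EM_image c /\
    forall z, TS2 z -> EM z = c -> EM_regular_point z].

Definition closed_values (R : realType) : set (R * R) :=
  closure (@regular_values R).

(* The topological boundary in the plane; the isolated critical value (1, 0) is
   interior to the closure, hence not in this set. *)
Definition boundary_values (R : realType) : set (R * R) :=
  closure (@closed_values R) `\` interior (@closed_values R).

Definition Pcubic (R : realType) (c : R * R) (x : R) : R :=
  2 * (c.1 - x) * (1 - x ^+ 2) - c.2 ^+ 2.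

Definition is_turning_points (R : realType) (c r : R * R) : Prop :=
  [/\ -1 <= r.1, r.1 < r.2, r.2 <= 1,
      Pcubic c r.1 = 0 /\ Pcubic c r.2 = 0
    & forall x, r.1 < x < r.2 -> 0 < Pcubic c x].

(* (x_-, x_+) *)
Definition turning_points (R : realType) (c : R * R) : R * R :=
  get [set r | is_turning_points c r].

(* When c.2 = 0 an endpoint may be -1 or 1, where the integrand has an integrable
   singularity; division by zero at that point is harmless for the Lebesgue
   integral. *)
Definition action1 (R : realType) (c : R * R) : R :=
  (pi : R)^-1 *
  \int[@lebesgue_measure R]_(x in `[(turning_points c).1, (turning_points c).2])
    (Num.sqrt (Pcubic c x) / (1 - x ^+ 2)).

(* The extension of action1 by continuity from regular_values to its closure. *)
Definition action1_ext (R : realType) (c : R * R) : R :=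
  if c \in @regular_values R then action1 c
  else lim (@action1 R @ within (@regular_values R) (nbhs c)).

Definition Hmin (R : realType) (l : R) : R :=
  let values := @Hfun R @` [set z | TS2 z /\ Lfun z = l] in
  get [set h | values h /\ lbound values h].

Definition is_quantized_energy (R : realType) (hbar : R) (n : nat) (m : int)
    (h : R) : Prop :=
  Hmin (m%:~R * hbar) <= h /\ action1_ext (h, m%:~R * hbar) = n%:R * hbar.

(* h_m(n) *)
Definition quantized_energy (R : realType) (hbar : R) (n : nat) (m : int) : R :=
  get [set h | is_quantized_energy hbar n m h].

(* On the torus (or circle, or point) over c the actions A_1 = action1_ext c and
   A_2 = c.2 are constant, so integrating them over an angle of period 2 pi turns
   the Bohr-Sommerfeld conditions into the two equations below. *)
Definition spectrum (R : realType) (hbar : R) : set (R * R) :=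
  [set c | closed_values c /\ exists n m : int,
    [/\ action1_ext c = n%:~R * hbar,
        c.2 = m%:~R * hbar
      & (regular_values c /\ 0 < n) \/ (boundary_values c /\ n = 0)]].

(* Main.v *)
Require Import Defs.
From HB Require Import structures.
From mathcomp Require Import all_boot all_order all_algebra.
From mathcomp Require Import all_classical all_reals all_analysis.
From mathcomp Require Import measurable_realfun.
From mathcomp Require Import ring lra.

Import Order.TTheory GRing.Theory Num.Theory.
Import numFieldNormedType.Exports.

Local Open Scope classical_set_scope.
Local Open Scope ring_scope.

Set Implicit Arguments.
Unset Strict Implicit.

(** Write P for [Pcubic c]. Since P <= 0 on [-1, 1] outside the turning points and the
    square root of a nonpositive number is 0, the action is
    pi^-1 * \int_(-1)^1 sqrt (P x) / (1 - x^2) dx for every c. In this form it is visibly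
    monotone in h, and it is continuous on the whole plane by dominated convergence, the
    integrand being at most a multiple of 1 / sqrt (1 - x^2). So the extension by
    continuity is given by the same integral on the closure of the regular values.

    The lowest energy at momentum l is 3 s / 2 - 1 / (2 s), where s in [-1, 0) solves
    (1 - s^2)^2 = - s l^2: there P has a double root at s and its third root is at least 1.
    Hence the action vanishes at the lowest energy and increases strictly and without bound
    above it, so that each level n * hbar is attained exactly once. Above the lowest energy
    all values other than (1, 0) are regular, and at (1, 0) the action is 4 / pi, which is
    not a multiple of hbar. *)

Local Notation coord := Defs.coord.
Local Notation EM := Defs.EM.
Local Notation Lfun := Defs.Lfun.

(** * The energy-momentum image *)

Definition vec3 (R : realType) (a b c : R) : 'rV[R]_3 :=
  \row_(i < 3) [:: a; b; c]`_i.

Lemma coord_vec3 (R : realType) (a b c : R) :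
  (coord (vec3 a b c) 0 = a) * (coord (vec3 a b c) 1 = b) * (coord (vec3 a b c) 2 = c).
Proof. by rewrite /coord !mxE. Qed.

Lemma dotE (R : realType) (u v : 'rV[R]_3) :
  dot u v = coord u 0 * coord v 0 + coord u 1 * coord v 1 + coord u 2 * coord v 2.
Proof.
rewrite /dot !big_ord_recl big_ord0 addr0 addrA /coord.
have -> : lift ord0 ord0 = 1 :> 'I_3 by exact/val_inj.
by have -> : lift ord0 (lift ord0 ord0) = 2 :> 'I_3 by exact/val_inj.
Qed.

(* The height q_3 of the horizontal circular orbit of angular momentum l; for l = 0 it is
   the south pole s = -1. *)
Definition is_lower_latitude (R : realType) (l s : R) :=
  [/\ -1 <= s, s < 0 & (1 - s ^+ 2) ^+ 2 = - s * l ^+ 2].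

(** Energy of that orbit: balance of forces gives <p, p> = - (1 - s^2) / s, hence H = s - (1 - s^2)
    / (2 s). *)
Definition lower_energy (R : realType) (s : R) : R := 3 / 2 * s - (2 * s)^-1.

Lemma lower_latitude_exists (R : realType) (l : R) : exists s, is_lower_latitude l s.
Proof.
pose f s : R := (1 - s ^+ 2) ^+ 2 + s * l ^+ 2.
have cf : {within `[-1, 0], continuous f}.
  apply: continuous_subspaceT => x; rewrite /f.
  apply: cvgD; last by apply: cvgMl; exact: cvg_id.
  apply: (@continuous_comp _ _ _ (fun x : R => 1 - x ^+ 2) (fun x => x ^+ 2)).
    by apply: cvgB; [exact: cvg_cst | exact: exprn_continuous].
  exact: exprn_continuous.
have f1 : f (-1) = - l ^+ 2 by rewrite /f; ring.
have f0 : f 0 = 1 by rewrite /f; ring.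
have [||s] := @IVT R f (-1) 0 0 _ cf; first by lra.
  by rewrite f1 f0 ge_min le_max ler01 oppr_le0 sqr_ge0 orbT.
rewrite in_itv/= => /andP[s1 s0] fs; exists s; split => //; last by move: fs; rewrite /f; lra.
by rewrite lt_neqAle s0 andbT; apply/eqP => s00; move: fs; rewrite s00 f0; lra.
Qed.

(** The roots of P sum to the energy, so a double root at s leaves - (s^2 + 1) / (2 s) as the third
    one. *)
Lemma Pcubic_lower_energy (R : realType) (l s x : R) : s < 0 ->
  (1 - s ^+ 2) ^+ 2 = - s * l ^+ 2 ->
  Pcubic (lower_energy s, l) x = 2 * (x - s) ^+ 2 * (x + (s ^+ 2 + 1) / (2 * s)).
Proof.
move=> s0 sl; rewrite /Pcubic /lower_energy/=.
have -> : l ^+ 2 = - (1 - s ^+ 2) ^+ 2 / s by rewrite sl; field; lra.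
by field; lra.
Qed.

(** Source of monotonicity in the energy: inside (-1, 1) the added term has the sign of h - h'. *)
Lemma PcubicE (R : realType) (h h' l x : R) :
  Pcubic (h, l) x = Pcubic (h', l) x + 2 * (h - h') * (1 - x ^+ 2).
Proof. by rewrite /Pcubic/=; ring. Qed.

Lemma Pcubic_lower_energy_le0 (R : realType) (l s x : R) : is_lower_latitude l s ->
  x <= 1 -> Pcubic (lower_energy s, l) x <= 0.
Proof.
move=> [s1 s0 sl] x1; rewrite (@Pcubic_lower_energy _ l s x s0 sl).
have -> : (s ^+ 2 + 1) / (2 * s) = - ((s ^+ 2 + 1) / (- 2 * s)) by field; lra.
(* The third root is at least 1 because (1 + s)^2 >= 0. *)
have : 1 <= (s ^+ 2 + 1) / (- 2 * s).
  by rewrite ler_pdivlMr; nra.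
by have := sqr_ge0 (x - s); nra.
Qed.

Lemma latitude_le_lower_energy (R : realType) (s : R) : -1 <= s -> s < 0 -> s <= lower_energy s.
Proof.
move=> s1 s0; rewrite /lower_energy -subr_ge0.
have -> : 3 / 2 * s - (2 * s)^-1 - s = (1 - s ^+ 2) / (- 2 * s) by field; lra.
by apply: divr_ge0; nra.
Qed.

(** The heights q_3 attained over c. The clause [x <= c.1] matters at the poles, where P x does not
    depend on the energy. *)
Definition classically_allowed (R : realType) (c : R * R) (x : R) :=
  [/\ -1 <= x, x <= 1, x <= c.1 & 0 <= Pcubic c x].

(** Below the lowest energy P is negative inside (-1, 1), so x is a pole. Then l = 0 and s = -1, and
    h < -1 <= x contradicts x <= h. *)
Lemma allowed_lower_energy (R : realType) (h l s x : R) : is_lower_latitude l s ->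
  classically_allowed (h, l) x -> lower_energy s <= h.
Proof.
move=> sl [/= x1 x1' xh Px]; rewrite leNgt; apply/negP => hs.
have := Pcubic_lower_energy_le0 sl x1'.
move: Px; rewrite (PcubicE h (lower_energy s) l x) => Px Ps.
have x2 : 0 <= 1 - x ^+ 2 by nra.
have {}x2 : 1 - x ^+ 2 = 0 by nra.
have {Ps} Ps : Pcubic (lower_energy s, l) x = 0 by nra.
have l0 : l = 0.
  by move: Ps; rewrite /Pcubic/= x2 mulr0 sub0r => /eqP; rewrite oppr_eq0 sqrf_eq0 => /eqP.
have s1 : s = -1.
  case: sl => s1 s0; rewrite l0 expr0n mulr0 => /eqP; rewrite sqrf_eq0 => /eqP; nra.
by move: hs; rewrite s1 /lower_energy; lra.
Qed.

Lemma lower_latitude_allowed (R : realType) (h l s : R) : is_lower_latitude l s ->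
  lower_energy s <= h -> classically_allowed (h, l) s.
Proof.
move=> [s1 s0 sl] hs; split => //=; first by lra.
  exact: le_trans (latitude_le_lower_energy s1 s0) hs.
rewrite (PcubicE h (lower_energy s)) Pcubic_lower_energy// subrr expr0n mulr0 mul0r add0r.
by apply: mulr_ge0; nra.
Qed.

Definition strictly_allowed (R : realType) (c : R * R) (x : R) :=
  [/\ -1 < x, x < 1 & 0 < Pcubic c x].

Lemma strictly_allowed_exists (R : realType) (h l s : R) : is_lower_latitude l s ->
  lower_energy s < h -> exists x, strictly_allowed (h, l) x.
Proof.
move=> [s1 s0 sl] hs; move: (s1); rewrite le_eqVlt => /predU1P[s1'|s1'].
  move: sl hs; rewrite -s1' => sl; rewrite /lower_energy => hs.
  have {}sl : l ^+ 2 = 0 by lra.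
  have h1 : -1 < h by lra.
  have [hle|hgt] := leP h 1.
    (* Here s is the pole -1, outside the open interval. The midpoint of -1 and h replaces it, or 0
       once h > 1. *)
    exists ((h - 1) / 2); split; rewrite /Pcubic/= ?sl ?subr0; [lra|lra|].
    by apply: mulr_gt0; [lra|nra].
  by exists 0; split; rewrite /Pcubic/= ?sl; nra.
exists s; split => //; first by lra.
rewrite (PcubicE h (lower_energy s)) Pcubic_lower_energy// subrr expr0n mulr0 mul0r add0r.
by apply: mulr_gt0; nra.
Qed.

Lemma EM_imageP (R : realType) (c : R * R) :
  EM_image c <-> exists x, classically_allowed c x.
Proof.
split.
  move=> [[q p]]; rewrite /TS2 /TS2_constraint/= !dotE.
  set q1 := coord q 0; set q2 := coord q 1; set q3 := coord q 2.
  set p1 := coord p 0; set p2 := coord p 1; set p3 := coord p 2.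
  move=> [qq qp] <-; exists q3.
  have e : 1 - q3 ^+ 2 = q1 ^+ 2 + q2 ^+ 2 by rewrite -qq; ring.
  have e0 : 0 <= 1 - q3 ^+ 2 by rewrite e addr_ge0// sqr_ge0.
  split; rewrite /EM/=; [by nra|by nra| |].
    by rewrite /Hfun dotE/= -/q3 -/p1 -/p2 -/p3; nra.
  rewrite /Pcubic /EM /Hfun /Lfun/= dotE/= -/q1 -/q2 -/q3 -/p1 -/p2 -/p3 e.
  (* Lagrange's identity in the horizontal plane turns P q3 into a sum of nonnegative terms. *)
  have -> : 2 * (2^-1 * (p1 * p1 + p2 * p2 + p3 * p3) + q3 - q3) * (q1 ^+ 2 + q2 ^+ 2) -
    (q1 * p2 - q2 * p1) ^+ 2 = (q1 * p1 + q2 * p2) ^+ 2 + p3 ^+ 2 * (q1 ^+ 2 + q2 ^+ 2).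
    by field.
  by rewrite addr_ge0 ?sqr_ge0// mulr_ge0 ?addr_ge0 ?sqr_ge0.
case: c => h l [x [/= x1 x1' xh Px]].
have [x2|x2] := eqVneq (x ^+ 2) 1.
  have l0 : l = 0.
    apply/eqP; rewrite -sqrf_eq0 -oppr_eq0 eq_le oppr_le0 sqr_ge0/=.
    by move: Px; rewrite /Pcubic/= x2 subrr mulr0 sub0r.
  (* At a pole every horizontal momentum is tangent and has angular momentum 0. *)
  exists (vec3 0 0 x, vec3 (Num.sqrt (2 * (h - x))) 0 0).
    rewrite /TS2 /TS2_constraint/= !dotE !coord_vec3.
    by congr pair; [rewrite -!expr2 x2|]; ring.
  rewrite /EM /Hfun /Lfun/= !dotE !coord_vec3 l0 -!expr2 sqr_sqrtr; last by lra.
  by congr pair; [field|ring].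
have {x2} x2 : 0 < 1 - x ^+ 2.
  by rewrite lt_neqAle; apply/andP; split; [rewrite eq_sym subr_eq0 eq_sym|nra].
set r := Num.sqrt (1 - x ^+ 2); set a := Num.sqrt (Pcubic (h, l) x / (1 - x ^+ 2)).
have r0 : r != 0 by rewrite gt_eqF// sqrtr_gt0.
have r2 : r ^+ 2 = 1 - x ^+ 2 by rewrite sqr_sqrtr// ltW.
have a2 : a ^+ 2 = 2 * (h - x) - l ^+ 2 / r ^+ 2.
  rewrite sqr_sqrtr; last by rewrite divr_ge0// ltW.
  by rewrite r2 /Pcubic/=; field; rewrite gt_eqF.
(* The eastward component l / r produces the angular momentum; the speed a along the meridian, in
   the direction (-x, 0, r), takes up the remaining kinetic energy. *)
exists (vec3 r 0 x, vec3 (- a * x) (l / r) (a * r)).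
  rewrite /TS2 /TS2_constraint/= !dotE !coord_vec3.
  by congr pair; [rewrite -!expr2 r2|]; ring.
rewrite /EM /Hfun /Lfun/= !dotE !coord_vec3.
congr pair; last by field.
rewrite (_ : _ + _ + _ = a ^+ 2 * (r ^+ 2 + x ^+ 2) + l ^+ 2 / r ^+ 2); last by field.
by rewrite a2 [in _ + x ^+ 2]r2; field.
Qed.

(** * Regular values *)

Lemma is_diff_continuous_linear (R : numFieldType) (V W : normedModType R)
  (f : V -> W) (x : V) : linear f -> continuous f -> is_diff x f f.
Proof.
move=> lf cf.
pose F : {linear V -> W} := HB.pack f (GRing.isLinear.Build _ _ _ _ f lf).
apply: DiffDef.
- exact: (@linear_differentiable _ _ _ F).
- exact: (@diff_lin _ _ _ F).
Qed.

Section differentials.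
Context {R : realType}.
Local Notation V := ('rV[R]_3 * 'rV[R]_3)%type.

(** Once the constraint and [EM] are written as polynomials in these linear functions, the sum and
    product rules give their differentials. *)
Definition position (i : 'I_3) (z : V) : R := coord z.1 i.
Definition momentum (i : 'I_3) (z : V) : R := coord z.2 i.

Lemma coord_continuous3 i : continuous (fun u : 'rV[R]_3 => coord u i).
Proof. exact: coord_continuous. Qed.

Lemma is_diff_position i z : is_diff z (position i) (position i).
Proof.
apply: is_diff_continuous_linear; first by move=> a u v; rewrite /position /coord /= !mxE.
by move=> x; apply: (@continuous_comp _ _ _ (fun z : V => z.1) (fun u => coord u i));
  [exact: cvg_fst | exact: coord_continuous3].
Qed.

Lemma is_diff_momentum i z : is_diff z (momentum i) (momentum i).
Proof.
apply: is_diff_continuous_linear; first by move=> a u v; rewrite /momentum /coord /= !mxE.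
by move=> x; apply: (@continuous_comp _ _ _ (fun z : V => z.2) (fun u => coord u i));
  [exact: cvg_snd | exact: coord_continuous3].
Qed.

Lemma diff_TS2_constraint (z w : V) : 'd (@TS2_constraint R) z w =
  (2 * dot z.1 w.1, dot z.1 w.2 + dot z.2 w.1).
Proof.
have -> : @TS2_constraint R = fun z : V =>
  ((position 0 * position 0 + position 1 * position 1 + position 2 * position 2) z,
   (position 0 * momentum 0 + position 1 * momentum 1 + position 2 * momentum 2) z).
  by apply/funext => y; rewrite /TS2_constraint !dotE.
pose dq i := is_diff_position i z; pose dp i := is_diff_momentum i z.
rewrite (diff_val (is_diff_def := is_diff_pair
  (is_diffD (is_diffD (is_diffM (dq 0) (dq 0)) (is_diffM (dq 1) (dq 1))) (is_diffM (dq 2) (dq 2)))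
  (is_diffD (is_diffD (is_diffM (dq 0) (dp 0)) (is_diffM (dq 1) (dp 1)))
    (is_diffM (dq 2) (dp 2))))).
rewrite !dotE /position /momentum !fctE.
rewrite /GRing.scale/=.
by congr pair; ring.
Qed.

Lemma diff_EM (z w : V) : 'd (@EM R) z w = (dot z.2 w.2 + coord w.1 2,
  coord z.1 0 * coord w.2 1 + coord z.2 1 * coord w.1 0
  - coord z.1 1 * coord w.2 0 - coord z.2 0 * coord w.1 1).
Proof.
have -> : @EM R = fun z : V =>
  ((2^-1 *: (momentum 0 * momentum 0 + momentum 1 * momentum 1 + momentum 2 * momentum 2)
    + position 2) z,
   (position 0 * momentum 1 - position 1 * momentum 0) z).
  by apply/funext => y; rewrite /EM /Hfun dotE.
pose dq i := is_diff_position i z; pose dp i := is_diff_momentum i z.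
rewrite (diff_val (is_diff_def := is_diff_pair
  (is_diffD (is_diffZ 2^-1 (is_diffD (is_diffD (is_diffM (dp 0) (dp 0)) (is_diffM (dp 1) (dp 1)))
    (is_diffM (dp 2) (dp 2)))) (dq 2))
  (is_diffB (is_diffM (dq 0) (dp 1)) (is_diffM (dq 1) (dp 0))))).
rewrite !dotE /position /momentum !fctE.
rewrite /GRing.scale/=.
by congr pair; field.
Qed.

End differentials.

Lemma strictly_allowed_not_lower (R : realType) (l s x : R) : is_lower_latitude l s ->
  ~ strictly_allowed (lower_energy s, l) x.
Proof.
move=> sl [x1 x1' Px]; have := Pcubic_lower_energy_le0 sl (ltW x1').
by rewrite leNgt Px.
Qed.

(** The first two equations say that (v, w) is tangent to TS^2, the last two that the differential
    of [EM] sends it to (a, b). Regularity becomes a solvable linear system. *)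
Lemma EM_regular_point_criterion (R : realType) (z : 'rV[R]_3 * 'rV[R]_3) :
  (forall a b : R, exists v1 v2 v3 w1 w2 w3 : R,
   let: (q1, q2, q3) := (coord z.1 0, coord z.1 1, coord z.1 2) in
   let: (p1, p2, p3) := (coord z.2 0, coord z.2 1, coord z.2 2) in
   [/\ q1 * v1 + q2 * v2 + q3 * v3 = 0,
       q1 * w1 + q2 * w2 + q3 * w3 + (p1 * v1 + p2 * v2 + p3 * v3) = 0,
       p1 * w1 + p2 * w2 + p3 * w3 + v3 = a &
       q1 * w2 + p2 * v1 - q2 * w1 - p1 * v2 = b]) ->
  EM_regular_point z.
Proof.
move=> H; apply/seteqP; split=> // -[a b] _.
have [v1 [v2 [v3 [w1 [w2 [w3 [e1 e2 e3 e4]]]]]]] := H a b.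
exists (vec3 v1 v2 v3, vec3 w1 w2 w3).
  by rewrite /tangent_TS2/= diff_TS2_constraint/= !dotE !coord_vec3 e1 e2 mulr0.
by rewrite diff_EM/= !dotE !coord_vec3 e3 e4.
Qed.

(** The critical points are the two equilibria and the horizontal circular orbits. The upper
    equilibrium has value (1, 0); over the values of all the others P <= 0 on [-1, 1]. *)
Lemma strictly_allowed_regular (R : realType) (c : R * R) (x : R) :
  strictly_allowed c x -> c <> (1, 0) -> regular_values c.
Proof.
move=> cx c10; split.
  case: (cx) => x1 x1' Px; apply/EM_imageP; exists x; split; rewrite ?ltW//.
  move: Px; rewrite /Pcubic => Px.
  have P0 : 0 < (c.1 - x) * (1 - x ^+ 2) by have := sqr_ge0 c.2; nra.
  by move: P0; rewrite pmulr_lgt0 ?subr_gt0//; nra.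
move=> [q p] []; rewrite !dotE /EM /Hfun /Lfun/= dotE => qq qp ec.
apply: EM_regular_point_criterion => a b /=.
move: qq qp ec; set q1 := coord q 0; set q2 := coord q 1; set q3 := coord q 2.
set p1 := coord p 0; set p2 := coord p 1; set p3 := coord p 2 => qq qp ec.
clearbody q1 q2 q3 p1 p2 p3.
have r2E : q1 ^+ 2 + q2 ^+ 2 = 1 - q3 ^+ 2 by rewrite -qq; ring.
have [r0|r0] := eqVneq (q1 ^+ 2 + q2 ^+ 2) 0.
  have q10 : q1 = 0 by apply/eqP; rewrite -sqrf_eq0; apply/eqP;
    have := sqr_ge0 q1; have := sqr_ge0 q2; lra.
  have q20 : q2 = 0 by apply/eqP; rewrite -sqrf_eq0; apply/eqP;
    have := sqr_ge0 q1; have := sqr_ge0 q2; lra.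
  subst q1 q2; have q3E : q3 ^+ 2 = 1 by lra.
  have p30 : p3 = 0 by rewrite -[p3]mul1r -q3E expr2 -mulrA;
    rewrite (_ : q3 * p3 = 0) ?mulr0//; lra.
  subst p3; have [N0|N0] := eqVneq (p1 ^+ 2 + p2 ^+ 2) 0.
    have p10 : p1 = 0 by apply/eqP; rewrite -sqrf_eq0; apply/eqP;
      have := sqr_ge0 p1; have := sqr_ge0 p2; lra.
    have p20 : p2 = 0 by apply/eqP; rewrite -sqrf_eq0; apply/eqP;
      have := sqr_ge0 p1; have := sqr_ge0 p2; lra.
    subst p1 p2; exfalso; move: q3E => /eqP; rewrite sqrf_eq1 => /orP[] /eqP q3E.
      by apply: c10; rewrite -ec q3E; congr pair; ring.
    case: cx => x1 x1'; rewrite /Pcubic -ec/= q3E => Px.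
    by have : 0 < (1 + x) * (1 - x ^+ 2); [apply: mulr_gt0; nra | move: Px; lra].
  pose A := a / (p1 ^+ 2 + p2 ^+ 2); pose B := b / (p1 ^+ 2 + p2 ^+ 2).
  (* At a pole, w along p changes H only, and v along p turned by a right angle changes L only. *)
  exists (B * p2), (- B * p1), 0, (A * p1), (A * p2), 0.
  by split; [ring|ring| |]; rewrite /A /B; field.
have [p30|p30] := eqVneq p3 0; last first.
  (* v = 0 and w a combination of e_3 - q3 q and e_3 x q. *)
  pose B := b / (q1 ^+ 2 + q2 ^+ 2); pose A := (a - B * (q1 * p2 - q2 * p1)) / p3.
  exists 0, 0, 0, (- A * q3 * q1 - B * q2), (- A * q3 * q2 + B * q1), (A * (q1 ^+ 2 + q2 ^+ 2)).
  split; [ring|ring| |by rewrite /B; field].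
  rewrite (_ : _ + _ = B * (q1 * p2 - q2 * p1) + A * (p3 * (q1 ^+ 2 + q2 ^+ 2 ) + (q3 ^+ 2) * p3)
    - A * q3 * (q1 * p1 + q2 * p2 + q3 * p3)); last by ring.
  by rewrite qp r2E mulr0 subr0 /A; field.
subst p3; pose L := q1 * p2 - q2 * p1; pose r := q1 ^+ 2 + q2 ^+ 2.
(* With v along e_3 - q3 q and w along e_3 x q, (dH, dL) has determinant r^2 + q3 L^2,
   which vanishes only on the horizontal circular orbits of lowest energy. *)
have D0 : r ^+ 2 + q3 * L ^+ 2 != 0.
  apply/eqP => D0.
  have r_gt0 : 0 < r by rewrite lt_neqAle eq_sym r0 addr_ge0 ?sqr_ge0.
  have q30 : q3 < 0.
    rewrite ltNge; apply/negP => q30; have : 0 < r ^+ 2 + q3 * L ^+ 2; last by lra.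
    by rewrite ltr_pwDl ?exprn_gt0// mulr_ge0// sqr_ge0.
  have sl : is_lower_latitude L q3.
    split => //; last by rewrite -r2E -/r; lra.
    by have : 0 < 1 - q3 ^+ 2; [rewrite -r2E | nra].
  apply: (@strictly_allowed_not_lower _ L q3 x sl).
  suff -> : (lower_energy q3, L) = c by [].
  rewrite -ec; congr pair.
  (* Since p is horizontal and orthogonal to q, Lagrange's identity recovers <p, p> from L; the
     energy is then the lowest one at momentum L. *)
  have pp : (p1 ^+ 2 + p2 ^+ 2) * r = L ^+ 2.
    rewrite (_ : _ * _ = L ^+ 2 + (q1 * p1 + q2 * p2 + q3 * 0) ^+ 2); last by rewrite /L /r; ring.
    by rewrite qp expr0n addr0.
  have {}pp : p1 ^+ 2 + p2 ^+ 2 = - r / q3.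
    apply: (mulIf (lt0r_neq0 r_gt0)).
    by rewrite pp; apply: (mulfI (ltr0_neq0 q30)); rewrite (_ : q3 * L ^+ 2 = - r ^+ 2);
      [field; rewrite lt_eqF|lra].
  rewrite (_ : _ * _ + _ * _ + _ * _ = p1 ^+ 2 + p2 ^+ 2); last by ring.
  by rewrite pp /r r2E /lower_energy; field; rewrite lt_eqF.
(* Cramer's rule for A r + B L = a and B r - A q3 L = b. *)
pose A := (r * a - L * b) / (r ^+ 2 + q3 * L ^+ 2).
pose B := (r * b + q3 * L * a) / (r ^+ 2 + q3 * L ^+ 2).
exists (- A * q3 * q1), (- A * q3 * q2), (A * r), (- B * q2), (B * q1), 0.
split.
- by rewrite /r; ring.
- rewrite (_ : _ + _ = - A * q3 * (q1 * p1 + q2 * p2 + q3 * 0)); last by rewrite /r; ring.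
  by rewrite qp mulr0.
- rewrite (_ : _ + _ = B * L + A * r); last by rewrite /r /L; ring.
  by rewrite /A /B; field.
- rewrite (_ : _ - _ = B * r - A * q3 * L); last by rewrite /r /L; ring.
  by rewrite /A /B; field.
Qed.

(** * The closure of the regular values *)

Lemma EM_image_lower (R : realType) (h l s : R) : is_lower_latitude l s ->
  EM_image (h, l) <-> lower_energy s <= h.
Proof.
move=> sl; rewrite EM_imageP; split=> [[x]|hs]; first exact: allowed_lower_energy.
by exists s; exact: lower_latitude_allowed.
Qed.

Lemma Pcubic_continuous (R : realType) :
  continuous (fun y : R * (R * R) => Pcubic y.2 y.1).
Proof.
move=> y; have cx : (fun y : R * (R * R) => y.1) @ y --> y.1 by exact: cvg_fst.
have c2 : (fun y : R * (R * R) => y.2) @ y --> y.2 by exact: cvg_snd.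
have ch : (fun y : R * (R * R) => y.2.1) @ y --> y.2.1.
  by apply: (cvg_comp _ fst c2); exact: cvg_fst.
have cl : (fun y : R * (R * R) => y.2.2) @ y --> y.2.2.
  by apply: (cvg_comp _ snd c2); exact: cvg_snd.
rewrite /Pcubic; apply: cvgB; last by rewrite expr2; apply: cvgM.
apply: cvgM; first by apply: cvgM; [exact: cvg_cst|exact: cvgB].
by apply: cvgB; [exact: cvg_cst|rewrite expr2; apply: cvgM].
Qed.

(** If c is outside the image, each x in [-1, 1] violates [x <= c.1] or 0 <= P x, and does so stably
    near (x, c). Compactness of [-1, 1] gives one neighbourhood of c for all x. *)
Lemma EM_image_closed (R : realType) : closed (@EM_image R).
Proof.
rewrite -openC openE => c cI; rewrite /interior.
have dK : \forall d \near c, `[-1, 1] `<=` [set x : R | ~ (x <= d.1 /\ 0 <= Pcubic d x)].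
  apply: (iffLR (compact_near_coveringP _) (@segment_compact R (-1) 1) _ (nbhs c)
    (fun d x => ~ (x <= d.1 /\ 0 <= Pcubic d x))) => x.
  rewrite /= in_itv/= => /andP[x1 x1'].
  have : ~ (x <= c.1 /\ 0 <= Pcubic c x).
    by move=> [xc Px]; apply: cI; apply/EM_imageP; exists x.
  rewrite not_andP => -[/negP|/negP]; rewrite -ltNge => H.
    have cf : (y.1 - y.2.1) @[y --> (x, c)] --> x - c.1.
      apply: cvgB; first exact: cvg_fst.
      by apply: (cvg_comp (fun y : R * (R * R) => y.2) fst); [exact: cvg_snd|exact: cvg_fst].
    have yx : \forall y \near (x, c), 0 < y.1 - y.2.1.
      by apply: (cvgr_gt _ cf); rewrite subr_gt0.
    apply: filterS yx => y /=; rewrite subr_gt0 => yx [].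
    by rewrite leNgt yx.
  have yx : \forall y \near (x, c), Pcubic y.2 y.1 < 0.
    by apply: (cvgr_lt _ (@Pcubic_continuous R (x, c))).
  by apply: filterS yx => y /= yx []; rewrite [0 <= _]leNgt yx.
apply: filterS dK => d dK /EM_imageP[x [x1 x1' xd Px]].
by apply: (dK x) => //=; rewrite in_itv/= x1.
Qed.

Lemma closed_values_EM_image (R : realType) : @closed_values R = @EM_image R.
Proof.
apply/seteqP; split.
  rewrite [X in _ `<=` X](iffLR (closure_id _) (@EM_image_closed R)).
  by apply: closure_subset => c [].
move=> [h l]; have [s sl] := lower_latitude_exists l.
move=> /(EM_image_lower h sl) hs B /nbhs_ballP[e /= e0 eB].
(* Raising the energy slightly gives a regular value, provided that the new energy avoids 1, hence
   the critical value (1, 0). *)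
have [t [t0 te t1]] : exists t, [/\ 0 < t, t < e & h + t <> 1].
  have [ht|ht] := eqVneq (h + e / 2) 1.
    by exists (e / 3); split; lra.
  by exists (e / 2); split; [lra|lra|exact/eqP].
exists (h + t, l); split; last first.
  apply: eB; split => /=; last exact: ballxx.
  by rewrite /ball/= opprD addrA subrr sub0r normrN gtr0_norm.
have [|x xs] := @strictly_allowed_exists _ (h + t) l s sl; first by lra.
by apply: (strictly_allowed_regular xs) => -[].
Qed.

Lemma boundary_values_lower (R : realType) (l s : R) : is_lower_latitude l s ->
  boundary_values (lower_energy s, l).
Proof.
move=> sl; split.
  by apply: subset_closure; rewrite closed_values_EM_image (EM_image_lower _ sl).
rewrite closed_values_EM_image => /nbhs_ballP[e /= e0 eB].
have : EM_image (lower_energy s - e / 2, l).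
  apply: eB; split => /=; last exact: ballxx.
  by rewrite /ball/= opprB addrC addrNK gtr0_norm; lra.
by rewrite (EM_image_lower _ sl); lra.
Qed.

Lemma Hmin_lower (R : realType) (l s : R) : is_lower_latitude l s ->
  Hmin l = lower_energy s.
Proof.
move=> sl.
(* The energies at momentum l form a closed ray, so the least one is unique and [get] returns it. *)
have valuesP h : (@Hfun R @` [set z | TS2 z /\ Lfun z = l]) h <-> lower_energy s <= h.
  rewrite -(EM_image_lower _ sl); split => [[z [zT zl] zh]|[z zT [zh zl]]].
    by exists z => //; rewrite /EM zh zl.
  by exists z.
apply: get_unique.
  by split; [apply/valuesP|move=> h /valuesP].
move=> h [/valuesP hs lb]; apply/eqP; rewrite eq_le hs andbT.
by apply: lb; apply/valuesP.
Qed.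

(** * Improper integrals *)

Section improper_FTC2.
Context {R : realType}.
Notation mu := (@lebesgue_measure R).
Variables (f F : R -> R) (a b : R).
Hypotheses (ab : a < b) (f0 : {in `]a, b[, forall x, 0 <= f x})
  (cf : {in `]a, b[, continuous f}) (cF : continuous F)
  (dF : {in `]a, b[, forall x : R, is_derive x 1 F (f x)}).

(** f may blow up at a and b. The usual theorem applies on the compact intervals [a + e n, b - e n];
    monotone convergence handles the integrals and continuity of F the right-hand sides. *)
Lemma ge0_continuous_FTC2_oo :
  (\int[mu]_(x in `]a, b[) (f x)%:E = (F b - F a)%:E)%E.
Proof.
pose e n : R := (b - a) / 3 * n.+1%:R^-1.
have e0 n : 0 < e n by rewrite /e mulr_gt0 ?invr_gt0 ?ltr0n// divr_gt0 ?subr_gt0.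
have e13 n : e n <= (b - a) / 3.
  by rewrite /e ler_piMr ?invf_le1 ?ler1n ?ltr0n// divr_ge0// subr_ge0 ltW.
have ecvg : e @ \oo --> (0 : R).
  by rewrite -[X in _ --> X](mulr0 ((b - a) / 3)); apply: cvgMr; exact: cvg_harmonic.
have ende n : {subset `[a + e n, b - e n] <= `]a, b[}.
  by move=> x; rewrite !in_itv/= => /andP[? ?]; have := e0 n => ?; apply/andP; split; lra.
pose K n := [set` `[a + e n, b - e n]].
have KU : \bigcup_n K n = `]a, b[%classic.
  apply/seteqP; split => [x [n _ /ende]//|x /= xab].
  have : \forall n \near \oo, e n < Num.min (x - a) (b - x).
    apply: (cvgr_lt _ ecvg); move: xab; rewrite in_itv/= => /andP[? ?].
    by rewrite lt_min !subr_gt0; apply/andP.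
  move=> [n _ /(_ n (leqnn _))]; rewrite /= lt_min => /andP[? ?].
  by exists n => //; rewrite /K/= in_itv/=; apply/andP; split; lra.
have mf n : measurable_fun (K n) (EFin \o f).
  apply/measurable_EFinP; apply: (@measurable_funS _ _ _ _ `]a, b[%classic) => //.
    by move=> x /ende.
  by apply: open_continuous_measurable_fun => // x; rewrite inE; exact: cf.
have intK n : (\int[mu]_(x in K n) (f x)%:E = (F (b - e n) - F (a + e n))%:E)%E.
  rewrite EFinB; apply: continuous_FTC2.
  - by move: (e n) (e13 n) ab => y; lra.
  - apply: continuous_in_subspaceT => x; rewrite inE => /ende; exact: cf.
  - split.
    + move=> x xn; have : x \in `]a, b[ by apply: (ende n); exact: subset_itv_oo_cc.
      by move=> /dF [].
    + by apply: cvg_at_right_filter; exact: cF.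
    + by apply: cvg_at_left_filter; exact: cF.
  - move=> x xn; have : x \in `]a, b[ by apply: (ende n); exact: subset_itv_oo_cc.
    by move=> /dF dFx; rewrite derive1E derive_val.
have cvg1 : (\int[mu]_(x in K n) (f x)%:E @[n --> \oo] --> \int[mu]_(x in `]a, b[) (f x)%:E)%E.
  have := @ge0_nondecreasing_set_cvg_integral _ (measurableTypeR R) R K (EFin \o f) mu.
  rewrite KU; apply => //.
  - apply/nondecreasing_seqP => n; apply/subsetPset => x; rewrite /K/= !in_itv/=.
    have : e n.+1 <= e n.
      by apply: ler_wpM2l; [rewrite divr_ge0// subr_ge0 ltW|rewrite lef_pV2 ?posrE ?ltr0n//
        ler_nat].
    by move=> ? /andP[? ?]; apply/andP; split; lra.
  - by move=> n; exact: measurable_itv.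
  - by move=> n x /ende ?; rewrite lee_fin f0.
have cvg2 : ((F (b - e n) - F (a + e n))%:E @[n --> \oo] --> (F b - F a)%:E)%E.
  apply: cvg_EFin; first exact: nearW.
  have cb : b - e n @[n --> \oo] --> b.
    by rewrite -[X in _ --> X](subr0 b); apply: cvgB => //; exact: cvg_cst.
  have ca : a + e n @[n --> \oo] --> a.
    by rewrite -[X in _ --> X](addr0 a); apply: cvgD => //; exact: cvg_cst.
  suff : (fun n => F (b - e n) - F (a + e n)) @ \oo --> F b - F a by [].
  by apply: cvgB; apply: continuous_cvg => //; exact: cF.
have {}cvg1 := cvg_lim (@ereal_hausdorff _) cvg1.
rewrite -cvg1 -(cvg_lim (@ereal_hausdorff _) cvg2).
by congr (lim (_ @ \oo)); apply/funext.
Qed.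

Lemma ge0_integrable_oo : mu.-integrable `]a, b[ (EFin \o f).
Proof.
apply/integrableP; split.
  apply/measurable_EFinP.
  by apply: open_continuous_measurable_fun => // x; rewrite inE; exact: cf.
under eq_integral => x do [rewrite inE/= => xab; rewrite /= ger0_norm ?f0//].
by rewrite ge0_continuous_FTC2_oo ltry.
Qed.

End improper_FTC2.

Lemma itvN11 (R : realType) (x : R) : x \in `]-1, 1[ -> -1 < x /\ x < 1.
Proof. by rewrite in_itv/= => /andP. Qed.

(** The values k = 1 and k = -1 give the two terms of [dominator], which is why these keep the shape
    k / sqrt (1 + k x). *)
Lemma is_derive_sqrt_affine (R : realType) (k x : R) : 0 < 1 + k * x ->
  is_derive x 1 (fun x => 2 * Num.sqrt (1 + k * x)) (k / Num.sqrt (1 + k * x)).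
Proof.
move=> kx.
have H1 : is_derive x 1 (fun x : R => 1 + k * x) k.
  have H : is_derive x 1 (cst 1 + k *: id) (0 + k *: (1 : R)).
    by apply: is_deriveD; apply: is_deriveZ.
  by apply: (is_derive_eq H); rewrite add0r /GRing.scale/= mulr1.
have H2 := is_derive1_sqrt kx.
have H3 : is_derive x 1 (Num.sqrt \o (fun x
  : R => 1 + k * x)) _ := @is_derive1_comp R Num.sqrt (fun x => 1 + k * x) x _ _ H2 H1.
have H4 : is_derive x 1 (2 *: (Num.sqrt \o (fun x : R => 1 + k * x))) _ := is_deriveZ 2 H3.
apply: (is_derive_eq H4).
by rewrite /GRing.scale/=; field; rewrite gt_eqF// sqrtr_gt0.
Qed.

Lemma continuous_sqrt_affine (R : realType) (k : R) :
  continuous (fun x => Num.sqrt (1 + k * x)).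
Proof.
move=> x; apply: (@continuous_comp _ _ _ (fun x => 1 + k * x) Num.sqrt).
  by apply: cvgD; [exact: cvg_cst|apply: cvgMr; exact: cvg_id].
exact: sqrt_continuous.
Qed.

(* At least 1 / sqrt (1 - x^2), with an explicit antiderivative. *)
Definition dominator (R : realType) (x : R) : R :=
  1 / Num.sqrt (1 + 1 * x) - (-1) / Num.sqrt (1 + (-1) * x).

Lemma continuous_inv_sqrt_affine (R : realType) (k x c : R) : 0 < 1 + k * x ->
  {for x, continuous (fun x => c / Num.sqrt (1 + k * x))}.
Proof.
move=> kx; apply: cvgMr; apply: cvgV; last exact: continuous_sqrt_affine.
by rewrite gt_eqF// sqrtr_gt0.
Qed.

Lemma dominator_integrable (R : realType) :
  (@lebesgue_measure R).-integrable `]-1, 1[ (EFin \o @dominator R).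
Proof.
apply: (@ge0_integrable_oo _ _ (fun x => 2 * Num.sqrt (1 + 1 * x) - 2 * Num.sqrt (1 + (-1) * x))).
- by lra.
- move=> x /itvN11[x1 x1']; rewrite /dominator mulNr opprK.
  by rewrite addr_ge0// divr_ge0// sqrtr_ge0.
- move=> x /itvN11[x1 x1']; apply: cvgB; apply: continuous_inv_sqrt_affine; lra.
- move=> x; apply: cvgB; apply: cvgMr; exact: continuous_sqrt_affine.
- move=> x /itvN11[x1 x1'].
  by apply: is_deriveB; apply: is_derive_sqrt_affine; lra.
Qed.

Lemma integral_inv_sqrt_add1 (R : realType) :
  \int[@lebesgue_measure R]_(x in `]-1, 1[) (1 / Num.sqrt (1 + 1 * x)) = 2 * Num.sqrt 2.
Proof.
rewrite /Rintegral (@ge0_continuous_FTC2_oo _ _ (fun x => 2 * Num.sqrt (1 + 1 * x))) /=.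
- by rewrite mulrN1 subrr sqrtr0 mulr0 subr0 mulr1.
- by lra.
- by move=> x /itvN11[x1 x1']; rewrite divr_ge0// sqrtr_ge0.
- move=> x /itvN11[x1 x1']; apply: continuous_inv_sqrt_affine; lra.
- move=> x; apply: cvgMr; exact: continuous_sqrt_affine.
- by move=> x /itvN11[x1 x1']; apply: is_derive_sqrt_affine; lra.
Qed.

(** * The action *)

Definition action_integrand (R : realType) (c : R * R) (x : R) : R :=
  Num.sqrt (Pcubic c x) / (1 - x ^+ 2).

Definition full_action (R : realType) (c : R * R) : R :=
  (pi : R)^-1 * \int[@lebesgue_measure R]_(x in `]-1, 1[) action_integrand c x.

(** * Turning points of the cubic *)

Lemma Pcubic_factor (R : realType) (c : R * R) (a b x : R) : a != b ->
  Pcubic c a = 0 -> Pcubic c b = 0 ->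
  Pcubic c x = 2 * (x - a) * (x - b) * (x - (c.1 - a - b)).
Proof.
rewrite /Pcubic -subr_eq0 => ab Pa Pb; apply: (mulfI ab); apply/eqP.
rewrite -subr_eq0; apply/eqP.
(* The third root comes from Vieta's formula; multiplied by a - b, the defect is P a (x - b) - P b
   (x - a). *)
rewrite (_ : _ - _ = (2 * (c.1 - a) * (1 - a ^+ 2) - c.2 ^+ 2) * (x - b)
  - (2 * (c.1 - b) * (1 - b ^+ 2) - c.2 ^+ 2) * (x - a)); last by ring.
by rewrite Pa Pb !mul0r subr0.
Qed.

Lemma Pcubic1_le0 (R : realType) (c : R * R) : Pcubic c 1 <= 0.
Proof. by rewrite /Pcubic expr1n subrr mulr0 sub0r oppr_le0 sqr_ge0. Qed.

Lemma PcubicN1_le0 (R : realType) (c : R * R) : Pcubic c (-1) <= 0.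
Proof. by rewrite /Pcubic sqrrN expr1n subrr mulr0 sub0r oppr_le0 sqr_ge0. Qed.

Lemma Pcubic_continuous_r (R : realType) (c : R * R) : continuous (Pcubic c).
Proof.
move=> x; rewrite /Pcubic; apply: cvgB; last exact: cvg_cst.
apply: cvgM; first by apply: cvgMr; apply: cvgB; [exact: cvg_cst|exact: cvg_id].
by apply: cvgB; [exact: cvg_cst|exact: exprn_continuous].
Qed.

(** Roots a < x < b come from the intermediate value theorem. As P x > 0, the third root t exceeds
    x, so the right turning point is the smaller of b and t. *)
Lemma turning_points_exist (R : realType) (c : R * R) (x : R) :
  strictly_allowed c x -> exists r, is_turning_points c r.
Proof.
move=> [x1 x1' Px].
have [|a] := @IVT R (Pcubic c) (-1) x 0 (ltW x1)
  (continuous_subspaceT (@Pcubic_continuous_r R c)).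
  by rewrite ge_min le_max PcubicN1_le0 (ltW Px) orbT.
rewrite in_itv/= => /andP[a1 ax] Pa.
have [|b] := @IVT R (Pcubic c) x 1 0 (ltW x1') (continuous_subspaceT (@Pcubic_continuous_r R c)).
  by rewrite ge_min le_max Pcubic1_le0 (ltW Px) orbT.
rewrite in_itv/= => /andP[xb b1] Pb.
have {}ax : a < x by rewrite lt_neqAle ax andbT; apply: contraTneq Px => <-; rewrite Pa ltxx.
have {}xb : x < b by rewrite lt_neqAle xb andbT; apply: contraTneq Px => ->; rewrite Pb ltxx.
have ab : a != b by rewrite lt_eqF// (lt_trans ax).
have PE y := Pcubic_factor y ab Pa Pb.
set t := c.1 - a - b in PE.
have xt : x < t.
  rewrite ltNge; apply/negP => tx; move: Px; rewrite PE ltNge => /negP; apply.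
  rewrite (_ : _ * _ = - (2 * (x - a) * (b - x) * (x - t))); last by ring.
  by rewrite oppr_le0 !mulr_ge0// subr_ge0; lra.
have [bt|tb] := leP b t.
  exists (a, b); split => //=; first exact: lt_trans xb.
  move=> y /andP[ay yb]; rewrite PE.
  have ? : 0 < (b - y) * (t - y) by apply: mulr_gt0; lra.
  by rewrite (_ : _ * _ = 2 * (y - a) * ((b - y) * (t - y))); [apply: mulr_gt0; lra|ring].
exists (a, t); split => //=; [exact: lt_trans xt|lra| |].
  by split => //; rewrite PE; ring.
move=> y /andP[ay yt]; rewrite PE.
have ? : 0 < (b - y) * (t - y) by apply: mulr_gt0; lra.
by rewrite (_ : _ * _ = 2 * (y - a) * ((b - y) * (t - y))); [apply: mulr_gt0; lra|ring].
Qed.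

(** Positivity between the turning points puts the third root t at or beyond [r.2]; if [r.2] < 1,
    then P 1 <= 0 even forces t >= 1. The signs of the factors follow. *)
Lemma turning_points_outside (R : realType) (c r : R * R) (x : R) :
  is_turning_points c r -> -1 <= x -> x <= 1 -> ~~ (r.1 <= x <= r.2) -> Pcubic c x <= 0.
Proof.
move=> [r1 r12 r2 [P1 P2] Pr] x1 x1'.
have PE y := Pcubic_factor y (negbT (lt_eqF r12)) P1 P2.
set t := c.1 - r.1 - r.2 in PE.
have r2t : r.2 <= t.
  (* At this point y, between both t and [r.1] and the root [r.2], P would not be positive. *)
  rewrite leNgt; apply/negP => tr2; pose y := (Num.max t r.1 + r.2) / 2.
  have tm : t <= Num.max t r.1 by rewrite le_max lexx.
  have r1m : r.1 <= Num.max t r.1 by rewrite le_max lexx orbT.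
  have mr2 : Num.max t r.1 < r.2 by rewrite gt_max tr2.
  have [r1y yr2 ty] : [/\ r.1 < y, y < r.2 & t < y].
    by move: (Num.max t r.1) @y tm r1m mr2 => m y *; rewrite /y; split; lra.
  have := Pr y; rewrite r1y yr2 PE => /(_ isT); rewrite ltNge => /negP; apply.
  rewrite (_ : _ * _ = - (2 * (y - r.1) * (r.2 - y) * (y - t))); last by ring.
  by rewrite oppr_le0 !mulr_ge0// subr_ge0 ltW.
rewrite negb_and -!ltNge PE => /orP[xr1|r2x].
  rewrite (_ : _ * _ = - (2 * (r.1 - x) * (r.2 - x) * (t - x))); last by ring.
  by rewrite oppr_le0 !mulr_ge0// subr_ge0; lra.
have t1 : 1 <= t.
  rewrite leNgt; apply/negP => t1; have := Pcubic1_le0 c; rewrite leNgt PE => /negP; apply.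
  by rewrite !mulr_gt0// subr_gt0; lra.
rewrite (_ : _ * _ = - (2 * (x - r.1) * (x - r.2) * (t - x))); last by ring.
by rewrite oppr_le0 !mulr_ge0// subr_ge0; lra.
Qed.

Lemma action_integrand_ge0 (R : realType) (c : R * R) (x : R) :
  -1 < x -> x < 1 -> 0 <= action_integrand c x.
Proof. by move=> x1 x1'; rewrite divr_ge0 ?sqrtr_ge0//; nra. Qed.

Lemma action1_full_action (R : realType) (c : R * R) : action1 c = full_action c.
Proof.
rewrite /action1 /full_action; congr (_ * _).
have [tp|ntp] := pselect (exists r, is_turning_points c r).
  have {}tp : is_turning_points c (turning_points c) by exact: getPex.
  rewrite [LHS]Rintegral_mkcond [RHS]Rintegral_mkcond.
  congr (Rintegral _ _ _); apply/funext => x; rewrite /patch !mem_setE.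
  case: (tp) => r1 r12 r2 _ _.
  case: ifPn; case: ifPn => //; rewrite !in_itv/= => xI xr.
    (* A turning point at -1 or 1 is missing from the open interval; there the quotient is a
       division by zero, with value 0. *)
    have xE : x ^+ 2 = 1 by move: xI; rewrite negb_and -!leNgt => /orP[] ?; nra.
    by rewrite xE subrr invr0 mulr0.
  move: xI => /andP[x1 x1']; rewrite /action_integrand.
  rewrite ler0_sqrtr ?mul0r//; exact: turning_points_outside tp (ltW x1) (ltW x1') xr.
have -> : turning_points c = (0, 0).
  (* [get] of an empty set is the distinguished point (0, 0). *)
  by apply: getPN => r rt; apply: ntp; exists r.
rewrite /= set_itv1 Rintegral_set1; apply/esym.
rewrite (@eq_Rintegral _ _ _ _ _ (cst 0)); first by rewrite Rintegral_cst// mul0r.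
move=> x; rewrite mem_setE => /itvN11[x1 x1']; rewrite /action_integrand ler0_sqrtr ?mul0r//.
by rewrite leNgt; apply/negP => Px; apply: ntp; apply: turning_points_exist; split;
  [exact: x1|exact: x1'|].
Qed.

(** * Bounds on the integrand *)

Lemma sqrtr_subadd (R : realType) (a b : R) :
  a <= b -> Num.sqrt b <= Num.sqrt a + Num.sqrt (b - a).
Proof.
(* Negative a must be covered as well, since P is negative beyond the turning points; its root is
   then 0. *)
move=> ab; have [a0|a0] := leP 0 a; last first.
  by rewrite (ler0_sqrtr (ltW a0)) add0r ler_wsqrtr//; lra.
rewrite -(@ler_pXn2r _ 2) ?nnegrE ?addr_ge0 ?sqrtr_ge0//.
rewrite sqrrD !sqr_sqrtr ?subr_ge0//; last exact: le_trans ab.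
by have := mulr_ge0 (sqrtr_ge0 a) (sqrtr_ge0 (b - a)); rewrite -mulr_natr; lra.
Qed.

Lemma inv_sqrt_dominated (R : realType) (x : R) : -1 < x -> x < 1 ->
  (Num.sqrt (1 - x ^+ 2))^-1 <= dominator x.
Proof.
move=> x1 x1'; rewrite /dominator !mul1r !mulN1r opprK.
have a0 : 0 < Num.sqrt (1 + x) by rewrite sqrtr_gt0; lra.
have b0 : 0 < Num.sqrt (1 - x) by rewrite sqrtr_gt0; lra.
rewrite (_ : 1 - x ^+ 2 = (1 + x) * (1 - x)); last by ring.
rewrite sqrtrM; last by lra.
have a2 : Num.sqrt (1 + x) ^+ 2 = 1 + x by rewrite sqr_sqrtr; lra.
have b2 : Num.sqrt (1 - x) ^+ 2 = 1 - x by rewrite sqr_sqrtr; lra.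
(* The claim reduces to 1 <= a + b, which follows from a^2 + b^2 = 2. *)
move: a0 b0 a2 b2; set a := Num.sqrt (1 + x); set b := Num.sqrt (1 - x).
move=> a0 b0 a2 b2.
rewrite (_ : a^-1 + b^-1 = (a + b) / (a * b)); last by field; rewrite !gt_eqF.
rewrite ler_pdivlMr ?mulr_gt0// mulVf; last by rewrite gt_eqF// mulr_gt0.
by nra.
Qed.

Lemma sqrt_div_dominated (R : realType) (k p x : R) : -1 < x -> x < 1 -> 0 <= k ->
  p <= k * (1 - x ^+ 2) -> Num.sqrt p / (1 - x ^+ 2) <= Num.sqrt k * dominator x.
Proof.
move=> x1 x1' k0 pk; have x2 : 0 < 1 - x ^+ 2 by nra.
apply: (@le_trans _ _ (Num.sqrt k * (Num.sqrt (1 - x ^+ 2))^-1)); last first.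
  by rewrite ler_wpM2l ?sqrtr_ge0// inv_sqrt_dominated.
rewrite ler_pdivrMr// -mulrA.
have -> : (Num.sqrt (1 - x ^+ 2))^-1 * (1 - x ^+ 2) = Num.sqrt (1 - x ^+ 2).
  rewrite -[X in _ * X](@sqr_sqrtr _ (1 - x ^+ 2)) ?ltW// expr2 mulrA mulVf ?mul1r//.
  by rewrite gt_eqF// sqrtr_gt0.
by rewrite -sqrtrM// ler_wsqrtr.
Qed.

Lemma action_integrand_continuous (R : realType) (c : R * R) (x : R) : -1 < x -> x < 1 ->
  {for x, continuous (action_integrand c)}.
Proof.
move=> x1 x1'; apply: cvgM.
  by apply: continuous_cvg; [exact: sqrt_continuous|exact: Pcubic_continuous_r].
apply: cvgV; first by rewrite gt_eqF//; nra.
by apply: cvgB; [exact: cvg_cst|exact: exprn_continuous].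
Qed.

Lemma action_integrand_dominated (R : realType) (M : R) (c : R * R) (x : R) :
  -1 < x -> x < 1 -> c.1 <= M -> 0 <= M ->
  action_integrand c x <= Num.sqrt (2 * (M + 1)) * dominator x.
Proof.
move=> x1 x1' cM M0; apply: sqrt_div_dominated => //; first by lra.
by have x2 : 0 < 1 - x ^+ 2; [nra|]; rewrite /Pcubic; have := sqr_ge0 c.2; nra.
Qed.

Lemma action_integrand_measurable (R : realType) (c : R * R) :
  measurable_fun (`]-1, 1[%classic : set R) (action_integrand c).
Proof.
apply: open_continuous_measurable_fun => // x.
by rewrite inE => /itvN11[? ?]; exact: action_integrand_continuous.
Qed.

Lemma action_integrand_integrable (R : realType) (c : R * R) :
  (@lebesgue_measure R).-integrable `]-1, 1[ (EFin \o action_integrand c).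
Proof.
have H : (@lebesgue_measure R).-integrable `]-1, 1[
    (fun x => (Num.sqrt (2 * (Num.max c.1 0 + 1)))%:E * (EFin \o @dominator R) x)%E.
  by apply: integrableZl => //; exact: dominator_integrable.
apply: (le_integrable _ _ _ H) => //.
- by apply/measurable_EFinP; exact: action_integrand_measurable.
- move=> x /itvN11[x1 x1']; rewrite /= lee_fin ger0_norm ?action_integrand_ge0//.
  apply: (le_trans (@action_integrand_dominated _ (Num.max c.1 0) _ _ x1 x1' _ _) (ler_norm _)).
    by rewrite le_max lexx.
  by rewrite le_max lexx orbT.
Qed.

(** Here P = 2 (1 - x)^2 (1 + x), so the integrand is sqrt 2 / sqrt (1 + x), whose integral is sqrt
    2 * 2 sqrt 2 = 4. *)
Lemma full_action_center (R : realType) : full_action (1 : R, 0 : R) = 4 / pi.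
Proof.
rewrite /full_action.
have -> : \int[@lebesgue_measure R]_(x in `]-1, 1[) action_integrand (1 : R, 0 : R) x =
    \int[@lebesgue_measure R]_(x in `]-1, 1[) (Num.sqrt 2 * (1 / Num.sqrt (1 + 1 * x))).
  apply: eq_Rintegral => x; rewrite mem_setE => /itvN11[x1 x1'];
    rewrite /action_integrand /Pcubic/=.
  rewrite (_ : 2 * (1 - x) * (1 - x ^+ 2) - 0 ^+ 2 = 2 * ((1 - x) ^+ 2 * (1 + x))); last by ring.
  rewrite sqrtrM// sqrtrM ?sqr_ge0// sqrtr_sqr gtr0_norm; last by lra.
  have a0 : 0 < Num.sqrt (1 + x) by rewrite sqrtr_gt0; lra.
  have a2 : Num.sqrt (1 + x) ^+ 2 = 1 + x by rewrite sqr_sqrtr; lra.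
  rewrite !mul1r (_ : 1 - x ^+ 2 = (1 - x) * Num.sqrt (1 + x) ^+ 2); last by rewrite a2; ring.
  by field; rewrite gt_eqF//=; lra.
rewrite RintegralZl//; last first.
  apply: (@ge0_integrable_oo _ _ (fun x => 2 * Num.sqrt (1 + 1 * x))).
  - by lra.
  - by move=> x /itvN11[x1 x1']; rewrite divr_ge0// sqrtr_ge0.
  - move=> x /itvN11[x1 x1']; apply: continuous_inv_sqrt_affine; lra.
  - move=> x; apply: cvgMr; exact: continuous_sqrt_affine.
  - by move=> x /itvN11[x1 x1']; apply: is_derive_sqrt_affine; lra.
have s2 : Num.sqrt 2 ^+ 2 = 2 :> R by rewrite sqr_sqrtr.
rewrite integral_inv_sqrt_add1; transitivity (Num.sqrt 2 ^+ 2 * 2 / pi : R); first by ring.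
by rewrite s2 -natrM.
Qed.

(** * Monotonicity and growth in the energy *)

Lemma action_integrand_le (R : realType) (h h' l x : R) : -1 < x -> x < 1 -> h <= h' ->
  action_integrand (h, l) x <= action_integrand (h', l) x.
Proof.
move=> x1 x1' hh; rewrite /action_integrand ler_wpM2r ?invr_ge0//; first by nra.
have ? : 0 <= (h' - h) * (1 - x ^+ 2) by apply: mulr_ge0; nra.
by rewrite ler_wsqrtr// (PcubicE h h') gerDl; lra.
Qed.

Lemma full_action_le (R : realType) (h h' l : R) : h <= h' ->
  full_action (h, l) <= full_action (h', l).
Proof.
move=> hh; rewrite ler_wpM2l ?invr_ge0 ?pi_ge0//.
apply: le_Rintegral => //; try exact: action_integrand_integrable.
by move=> x /itvN11[x1 x1']; exact: action_integrand_le.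
Qed.

Lemma Rintegral_gt0_continuous (R : realType) (f : R -> R) (a b x : R) :
  (@lebesgue_measure R).-integrable `]a, b[ (EFin \o f) ->
  {in `]a, b[, forall y, 0 <= f y} -> {for x, continuous f} -> x \in `]a, b[ -> 0 < f x ->
  0 < \int[@lebesgue_measure R]_(y in `]a, b[) f y.
Proof.
move=> intf f0 cf xab fx0.
have : \forall y \near x, f x / 2 < f y by apply: (cvgr_gt _ cf); lra.
move=> /nbhs_ballP[e /= e0 eB].
pose d := Num.min e (b - x) / 2.
move: xab; rewrite in_itv/= => /andP[ax xb].
have d0 : 0 < d by rewrite divr_gt0// lt_min e0 subr_gt0.
have de : d < e by rewrite ltr_pdivrMr// (le_lt_trans (_ : _ <= e))//; [rewrite ge_min lexx|lra].
have db : d < b - x by rewrite ltr_pdivrMr// (le_lt_trans (_ : _ <= b - x))//;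
  [rewrite ge_min lexx orbT|lra].
have sub : `[x, x + d] `<=` (`]a, b[%classic : set R).
  by move=> y /=; rewrite !in_itv/= => /andP[? ?]; apply/andP; split; lra.
have mf := measurable_int _ intf.
apply: (@lt_le_trans _ _ (f x / 2 * d)); first by apply: mulr_gt0 => //; lra.
rewrite -lee_fin /Rintegral fineK; last exact: integrable_fin_num.
have le1 : ((f x / 2 * d)%:E <= \int[@lebesgue_measure R]_(y in `[x, (x + d)%R]) (f x / 2)%:E)%E.
  rewrite integral_cst//= lebesgue_measure_itv/= lte_fin ltrDl d0 -EFinB -EFinM lee_fin.
  by rewrite addrAC subrr add0r.
have le2 : (\int[@lebesgue_measure R]_(y in `[x, (x + d)%R]) (f x / 2)%:E <=
    \int[@lebesgue_measure R]_(y in `[x, (x + d)%R]) (f y)%:E)%E.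
  apply: ge0_le_integral => //=.
  - by move=> y _; rewrite lee_fin; lra.
  - by apply: (measurable_funS _ sub mf).
  - move=> y; rewrite in_itv/= => /andP[xy yd]; rewrite lee_fin ltW//; apply: eB.
    by rewrite /ball/= distrC ger0_norm; lra.
apply: le_trans le1 (le_trans le2 _).
by apply: ge0_subset_integral => //= y yab; rewrite lee_fin; exact: f0.
Qed.

(** The integrands are ordered, continuous, and distinct at x, where the larger cubic is positive;
    so their difference has positive integral. *)
Lemma full_action_lt (R : realType) (h h' l x : R) : h < h' -> strictly_allowed (h', l) x ->
  full_action (h, l) < full_action (h', l).
Proof.
move=> hh [x1 x1' Px]; rewrite /full_action ltr_pM2l ?invr_gt0 ?pi_gt0// -subr_gt0.
rewrite -RintegralB//; try exact: action_integrand_integrable.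
have x2 : 0 < 1 - x ^+ 2 by nra.
apply: (@Rintegral_gt0_continuous _ _ _ _ x).
- apply: (integrableB _ (action_integrand_integrable (h', l))
    (action_integrand_integrable (h, l))).
  exact: measurable_itv.
- by move=> y /itvN11[y1 y1']; rewrite subr_ge0 action_integrand_le// ltW.
- by apply: cvgB; exact: action_integrand_continuous.
- by rewrite in_itv/= x1.
rewrite subr_gt0 /action_integrand ltr_pM2r ?invr_gt0// ltr_sqrt//.
by rewrite (PcubicE h h'); nra.
Qed.

Lemma full_action_eq0 (R : realType) (c : R * R) : (forall x, ~ strictly_allowed c x) ->
  full_action c = 0.
Proof.
move=> nc; rewrite /full_action (@eq_Rintegral _ _ _ _ _ (cst 0)).
  by rewrite Rintegral_cst// mul0r mulr0.
move=> x; rewrite mem_setE => /itvN11[x1 x1']; rewrite /action_integrand ler0_sqrtr ?mul0r//.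
by rewrite leNgt; apply/negP => Px; apply: (nc x).
Qed.

Lemma full_action_unbounded (R : realType) (l T : R) : 0 <= T ->
  exists H, forall h, H <= h -> T <= full_action (h, l).
Proof.
(* Chosen so that P >= (3 / 2) (H - 1 / 2) - l^2 = (pi T)^2 on [-1/2, 1/2], an interval of length 1
   where 1 - y^2 >= 3 / 4. *)
move=> T0; pose H := 2^-1 + (l ^+ 2 + (pi * T) ^+ 2) * 2 / 3.
exists H => h Hh; apply: le_trans (full_action_le l Hh).
rewrite /full_action mulrC ler_pdivlMr ?pi_gt0// mulrC.
rewrite -lee_fin /Rintegral fineK; last first.
  by apply: integrable_fin_num => //; exact: action_integrand_integrable.
have sub : `[- 2^-1, 2^-1] `<=` (`]-1, 1[%classic : set R).
  by move=> y /=; rewrite !in_itv/= => /andP[? ?]; apply/andP; split; lra.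
have le1 : ((pi * T)%:E <= \int[@lebesgue_measure R]_(y in `[(- 2^-1)%R, 2^-1%R]) (pi * T)%:E)%E.
  rewrite integral_cst//= lebesgue_measure_itv/= lte_fin ifT; last by lra.
  rewrite -EFinB -EFinM lee_fin.
  by rewrite (_ : 2^-1 - - 2^-1 = 1) ?mulr1//; lra.
have le2 : (\int[@lebesgue_measure R]_(y in `[(- 2^-1)%R, 2^-1%R]) (pi * T)%:E <=
    \int[@lebesgue_measure R]_(y in `[(- 2^-1)%R, 2^-1%R]) (action_integrand (H, l) y)%:E)%E.
  apply: ge0_le_integral => //=.
  - by move=> y _; rewrite lee_fin mulr_ge0// pi_ge0.
  - apply: (measurable_funS _ sub) => //.
    by apply/measurable_EFinP; exact: action_integrand_measurable.
  - move=> y; rewrite in_itv/= => /andP[y1 y2]; rewrite lee_fin.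
    have pT : 0 <= pi * T by rewrite mulr_ge0// pi_ge0.
    have y3 : 3 / 4 <= 1 - y ^+ 2 by nra.
    rewrite ler_pdivlMr; last by lra.
    apply: (@le_trans _ _ (pi * T)); first by rewrite ler_piMr//; nra.
    rewrite -[leLHS]ger0_norm// -sqrtr_sqr ler_wsqrtr// /Pcubic/= /H.
    have := sqr_ge0 l; have := sqr_ge0 (pi * T); move: (l ^+ 2) ((pi * T) ^+ 2) => A B.
    nra.
apply: le_trans le1 (le_trans le2 _).
apply: ge0_subset_integral => //=.
  by apply/measurable_EFinP; exact: action_integrand_measurable.
by move=> y /itvN11[y1 y2]; rewrite lee_fin; exact: action_integrand_ge0.
Qed.

(** * Continuity of the action *)

Lemma full_action_lipschitz_sqrt (R : realType) (h h' l : R) : h <= h' ->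
  full_action (h', l) - full_action (h, l) <= Num.sqrt (2 * (h' - h)) *
    (pi^-1 * \int[@lebesgue_measure R]_(x in `]-1, 1[) dominator x).
Proof.
move=> hh; rewrite /full_action -mulrBr mulrCA ler_wpM2l ?invr_ge0 ?pi_ge0//.
rewrite -RintegralB//; try exact: action_integrand_integrable.
rewrite -RintegralZl//; last exact: dominator_integrable.
apply: le_Rintegral => //.
- apply: (integrableB _ (action_integrand_integrable (h', l))
    (action_integrand_integrable (h, l))).
  exact: measurable_itv.
- apply: (integrableZl _ _ (dominator_integrable R)); exact: measurable_itv.
- move=> x /itvN11[x1 x1']; have x2 : 0 < 1 - x ^+ 2 by nra.
  rewrite /action_integrand -mulrBl.
  (* Subadditivity of the root bounds the difference of the two roots by the root of the difference
     of the cubics, which does not involve l. *)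
  apply: (@le_trans _ _ (Num.sqrt (2 * (h' - h) * (1 - x ^+ 2)) / (1 - x ^+ 2))).
    apply: ler_wpM2r; first by rewrite invr_ge0 ltW.
    rewrite lerBlDl.
    have -> : 2 * (h' - h) * (1 - x ^+ 2) = Pcubic (h', l) x - Pcubic (h, l) x.
      by rewrite (PcubicE h' h); ring.
    by apply: sqrtr_subadd; rewrite (PcubicE h' h) lerDl; nra.
  by apply: sqrt_div_dominated => //; lra.
Qed.

Lemma full_action_continuous_r (R : realType) (h : R) :
  continuous (fun l => full_action (h, l)).
Proof.
move=> l; apply: cvgMr.
have l1 : l \in `]l - 1, l + 1[ by rewrite in_itv/=; apply/andP; split; lra.
apply: (@continuity_under_integral R _ _ (@lebesgue_measure R)
  (fun l x => action_integrand (h, l) x) `]-1, 1[%classic _ (l - 1) (l + 1) _ _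
  (fun x => Num.sqrt (2 * (Num.max h 0 + 1)) * dominator x)) => //.
- by move=> k _; exact: action_integrand_integrable.
- apply: aeW => x /itvN11[x1 x1'] k _.
  apply: cvgMl; apply: continuous_cvg; first exact: sqrt_continuous.
  by rewrite /Pcubic/=; apply: cvgB; [exact: cvg_cst|exact: exprn_continuous].
- apply: (integrableZl _ _ (dominator_integrable R)); exact: measurable_itv.
- move=> k _; apply: aeW => x /itvN11[x1 x1'].
  rewrite ger0_norm ?action_integrand_ge0// action_integrand_dominated//=.
    by rewrite le_max lexx.
  by rewrite le_max lexx orbT.
- by rewrite inE/=.
Qed.

(** Continuity in l at fixed h extends to the plane because the modulus of continuity in h is
    uniform in l. *)
Lemma full_action_continuous (R : realType) : continuous (@full_action R).
Proof.
move=> [h l]; set K := pi^-1 * \int[@lebesgue_measure R]_(x in `]-1, 1[) dominator x.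
have lip k (h' : R) : `|full_action (h', k) - full_action (h, k)| <= Num.sqrt (2 * `|h' - h|) * K.
  have [hh|hh] := leP h h'.
    rewrite ger0_norm ?subr_ge0 ?full_action_le//.
    by rewrite ger0_norm ?subr_ge0//; exact: full_action_lipschitz_sqrt.
  rewrite distrC ger0_norm ?subr_ge0 ?full_action_le ?(ltW hh)//.
  by rewrite distrC ger0_norm ?subr_ge0 ?(ltW hh)//; exact: full_action_lipschitz_sqrt (ltW hh).
have c1 : (fun c : R * R => Num.sqrt (2 * `|c.1 - h|) * K) @ (h, l) --> 0.
  rewrite (_ : 0 = Num.sqrt (2 * `|h - h|) * K); last by rewrite subrr normr0 mulr0 sqrtr0 mul0r.
  apply: cvgMl; apply: continuous_cvg; first exact: sqrt_continuous.
  apply: cvgMr; apply: cvg_norm; apply: cvgB; last exact: cvg_cst.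
  exact: (@cvg_fst _ _ (nbhs h) (nbhs l)).
have c2 : (fun c : R * R => full_action (h, c.2)) @ (h, l) --> full_action (h, l).
  apply: (@cvg_comp _ _ _ snd (fun k => full_action (h, k))).
    exact: (@cvg_snd _ _ (nbhs h) (nbhs l)).
  exact: full_action_continuous_r.
have c3 : (fun c : R * R => full_action c - full_action (h, c.2)) @ (h, l) --> 0.
  apply/cvgr0Pnorm_le => e e0.
  have H : \forall c \near (h, l), Num.sqrt (2 * `|c.1 - h|) * K <= e.
    by apply: (cvgr_le _ c1).
  apply: filterS H => -[h' k] /=.
  exact: le_trans (lip _ _).
have := cvgD c3 c2; rewrite add0r.
rewrite (_ : (fun c => full_action c - full_action (h, c.2)) + _ = @full_action R); first exact.
by apply/funext => c; rewrite fctE subrK.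
Qed.

(** * Quantization *)

Lemma action1_ext_full_action (R : realType) (c : R * R) : EM_image c ->
  action1_ext c = full_action c.
Proof.
rewrite -closed_values_EM_image => cc; rewrite /action1_ext.
have -> : @action1 R = @full_action R by apply/funext => d; exact: action1_full_action.
case: ifP => // _.
(* As c lies in the closure of the regular values, this filter is proper, so the limit is unique. *)
have PF : ProperFilter (within (@regular_values R) (nbhs c)) by exact: within_nbhs_proper.
apply: cvg_lim => //.
by apply: cvg_within_filter; exact: full_action_continuous.
Qed.

Lemma full_action_lower (R : realType) (l s : R) : is_lower_latitude l s ->
  full_action (lower_energy s, l) = 0.
Proof. by move=> sl; apply: full_action_eq0 => x; exact: strictly_allowed_not_lower. Qed.

Lemma full_action_incr (R : realType) (h h' l s : R) : is_lower_latitude l s ->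
  lower_energy s <= h -> h < h' -> full_action (h, l) < full_action (h', l).
Proof.
move=> sl sh hh; have [x xs] := strictly_allowed_exists sl (le_lt_trans sh hh).
exact: full_action_lt hh xs.
Qed.

Lemma full_action_level (R : realType) (l s T : R) : is_lower_latitude l s -> 0 <= T ->
  exists! h, lower_energy s <= h /\ full_action (h, l) = T.
Proof.
move=> sl T0; have [H HT] := full_action_unbounded l T0.
have sH : lower_energy s <= Num.max H (lower_energy s) by rewrite le_max lexx orbT.
have cA : continuous (fun h => full_action (h, l)).
  move=> h; apply: (@continuous_comp _ _ _ (fun h : R => (h, l)) (@full_action R)).
    move=> B [[U V] [/= hU lV] UV]; apply: filterS hU => y Uy.
    by apply: UV; split => //=; exact: nbhs_singleton.
  exact: full_action_continuous.
have [|h] := @IVT R (fun h => full_action (h, l)) _ _ T sH (continuous_subspaceT cA).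
  rewrite /= full_action_lower// ge_min le_max T0 /=.
  by rewrite HT ?orbT// le_max lexx.
rewrite in_itv/= => /andP[sh _] hT; exists h; split => // k [sk kT].
have [hk|kh|//] := ltgtP h k.
  by have := full_action_incr sl sh hk; rewrite hT kT ltxx.
by have := full_action_incr sl sk kh; rewrite hT kT ltxx.
Qed.

Lemma is_quantized_energyE (R : realType) (hbar s h : R) (n : nat) (m : int) :
  is_lower_latitude (m%:~R * hbar) s ->
  is_quantized_energy hbar n m h <->
  lower_energy s <= h /\ full_action (h, m%:~R * hbar) = n%:R * hbar.
Proof.
move=> sl; rewrite /is_quantized_energy (Hmin_lower sl).
by split=> -[sh hA]; split => //; move: hA;
  rewrite action1_ext_full_action//; apply/(EM_image_lower _ sl).
Qed.

Theorem mainTheorem5 (R : realType) (hbar : R) (hbar_gt0 : 0 < hbar)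
    (hbar_generic : forall k : int, 4 / pi <> k%:~R * hbar) :
  [/\ forall (n : nat) (m : int), exists! h : R, is_quantized_energy hbar n m h,
      @closed_values R = @EM_image R,
      forall (n : nat) (m : int),
        closed_values (quantized_energy hbar n m, m%:~R * hbar)
    & spectrum hbar =
        range (fun nm : nat * int =>
          (quantized_energy hbar nm.1 nm.2, nm.2%:~R * hbar))].
Proof.
have unique n m : exists! h : R, is_quantized_energy hbar n m h.
  have [s sl] := lower_latitude_exists (m%:~R * hbar).
  have [|h [hP hU]] := full_action_level sl (_ : 0 <= n%:R * hbar).
    by rewrite mulr_ge0// ltW.
  exists h; split; first exact/(is_quantized_energyE _ _ sl).
  by move=> k /(is_quantized_energyE _ _ sl); exact: hU.
have quantizedP n m : is_quantized_energy hbar n m (quantized_energy hbar n m).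
  by have [h [hP _]] := unique n m; apply: getPex; exists h.
split => //; first exact: closed_values_EM_image.
  move=> n m; have [s sl] := lower_latitude_exists (m%:~R * hbar).
  have /(is_quantized_energyE _ _ sl)[sh _] := quantizedP n m.
  by rewrite closed_values_EM_image; apply/(EM_image_lower _ sl).
apply/seteqP; split.
  move=> [h l] [hl [n [m [/= A1 lE nE]]]]; subst l.
  have {}nE : 0 <= n by case: nE => -[_]; [exact: ltW|move=> ->].
  have [s sl] := lower_latitude_exists (m%:~R * hbar).
  (* Both alternatives give n >= 0, so the absolute value loses nothing; uniqueness of the level
     then identifies h. *)
  exists (`|n|%N, m) => //=; congr pair.
  have [k [_ kU]] := unique `|n|%N m.
  rewrite -(kU _ (quantizedP _ _)) -(kU h)//.
  apply/(is_quantized_energyE _ _ sl); move: hl; rewrite closed_values_EM_image => hl.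
  split; first exact/(EM_image_lower _ sl).
  by rewrite -action1_ext_full_action// A1 -[in LHS](gez0_abs nE).
move=> _ [[n m] _ <-] /=; set h := quantized_energy hbar n m.
have [s sl] := lower_latitude_exists (m%:~R * hbar).
have /(is_quantized_energyE _ _ sl)[sh hA] := quantizedP n m.
have hI : EM_image (h, m%:~R * hbar) by apply/(EM_image_lower _ sl).
split; first by rewrite closed_values_EM_image.
exists n%:Z, m; split => //; first by rewrite action1_ext_full_action.
(* Level 0 is the lowest energy, a boundary value; positive levels lie strictly above it. *)
case: n @h hA sh hI => [|n] h hA sh hI; [right|left]; split => //.
  suff -> : h = lower_energy s by exact: boundary_values_lower.
  apply/eqP; rewrite eq_le sh andbT leNgt; apply/negP => hs.
  have := full_action_incr sl (lexx _) hs.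
  by rewrite full_action_lower// hA mul0r ltxx.
have sh' : lower_energy s < h.
  rewrite lt_neqAle sh andbT; apply/eqP => hs.
  have : 0 < n.+1%:R * hbar by rewrite mulr_gt0.
  by rewrite -hA -/h -hs full_action_lower// ltxx.
have [x xs] := strictly_allowed_exists sl sh'.
apply: (strictly_allowed_regular xs) => h1.
(* The value (1, 0) would make 4 / pi equal to (n + 1) [hbar]. *)
by apply: (hbar_generic n.+1%:Z); rewrite -full_action_center -h1 hA.
Qed.
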